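(* Suppose $p\ge 5$ is a prime and $n$ is a positive integer. For $x\in\{\frac12,\frac13,\frac14,\frac16\}$, we have $$\sum_{k=0}^{np-1}\frac{(x)_k(1-x)_k}{(1)_k^2}\equiv (-1)^{\langle -x\rangle_p}\sum_{k=0}^{n-1}\frac{(x)_k(1-x)_k}{(1)_k^2}\pmod{p^2}.$$
   Context: For a number $a$, $(a)_0=1$ and $(a)_k=a(a+1)\cdots(a+k-1)$ for $k\ge1$ (so $(1)_k=k!$). The sum $\sum_{k=0}^{m-1}\frac{(x)_k(1-x)_k}{(1)_k^2}$ is the truncated hypergeometric series ${}_2F_1\left[\begin{smallmatrix}x,\,1-x\\1\end{smallmatrix};1\right]_m$. For a $p$-adic integer $a$, $\langle a\rangle_p$ denotes the least non-negative integer $r$ with $a\equiv r\pmod p$. Congruences modulo $p^2$ between rational numbers are understood in the ring of $p$-adic integers (equivalently, the difference lies in $p^2\mathbb{Z}_{(p)}$). *)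

(* Defs.v *)
From HB Require Import structures.
From mathcomp Require Import all_boot all_order all_algebra.
From mathcomp Require Import ring.

Set Implicit Arguments.
Unset Strict Implicit.
Unset Printing Implicit Defensive.

Import Order.TTheory GRing.Theory Num.Theory.
Local Open Scope ring_scope.

(* (a)_k = a (a + 1) ... (a + k - 1) *)
Definition pochhammer (R : pzSemiRingType) (a : R) (k : nat) : R :=
  \prod_(i < k) (a + i%:R).

(* Z_(p), the ring of rational p-adic integers *)
Definition Zlocal (p : nat) : {pred rat} :=
  [pred q : rat | ~~ (p %| `|denq q|)%N].

(* a = b mod p ^ e, i.e. a - b \in p ^ e Z_(p) (for p != 0) *)
Definition congr_pexp (p e : nat) (a b : rat) : bool :=
  (a - b) / p%:R ^+ e \in Zlocal p.

(* <a>_p: the least r with a = r mod p, for a in Z_(p). Such an r exists below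
   p, so searching 0, ..., p - 1 suffices; the value is p if there is none,
   i.e. if a is not in Z_(p). *)
Definition least_residue (p : nat) (a : rat) : nat :=
  find (fun r => congr_pexp p 1 a r%:R) (iota 0 p).

Lemma denq_dvd (q : rat) (w d : int) : q * d%:~R = w%:~R -> (denq q %| d)%Z.
Proof.
move=> h; rewrite -(Gauss_dvdzr (n := numq q)) ; last first.
  by rewrite coprimez_sym; exact: coprime_num_den.
apply/dvdzP; exists w; apply/eqP; rewrite -(eqr_int rat) !intrM -h.
by rewrite mulrAC numqE.
Qed.

Lemma least_residueP (p : nat) (a : rat) : prime p -> a \in Zlocal p ->
  (least_residue p a < p)%N /\ congr_pexp p 1 a (least_residue p a)%:R.
Proof.
move=> pp; rewrite inE /= => pa.
have p0 : (p%:Z != 0) by case: p pp {pa}.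
have co : coprimez (denq a) p.
  by rewrite /coprimez /gcdz /= gcdnC -[X in is_true X]/(coprime p `|denq a|) prime_coprime.
have [u [v uv]] : exists u v : int, u * denq a + v * p%:Z = 1.
  case: (Bezoutz (denq a) p) => u [v E]; exists u, v.
  by rewrite E; move/eqP: co.
suff H : has (fun r => congr_pexp p 1 a r%:R) (iota 0 p).
  have L : (least_residue p a < p)%N by rewrite -[X in (_ < X)%N](size_iota 0) -has_find.
  by split => //; have := nth_find 0%N H; rewrite nth_iota.
pose m := (numq a * u %% p)%Z.
have m0 : 0 <= m by exact: modz_ge0.
have mE : m = `|m|%N by rewrite gez0_abs.
apply/hasP; exists `|m|%N.
  by rewrite mem_iota /= add0n -ltz_nat -mE ltz_pmod // ltz_nat prime_gt0.
rewrite /congr_pexp inE /= expr1; apply: contra pa => pd.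
apply: (dvdn_trans pd); rewrite -/(dvdz _ _).
apply: (@denq_dvd _ (numq a * v + (numq a * u %/ p)%Z * denq a)).
have pR : (p%:R : rat) != 0 by rewrite pnatr_eq0 -lt0n prime_gt0.
apply: (mulIf pR); rewrite mulrAC divfK //.
rewrite mulrBl -numqE [(`|m|%N)%:R](_ : _ = m%:~R); last by rewrite [in RHS]mE.
have -> : (p%:R : rat) = (p%:Z)%:~R by [].
rewrite -!(intrM, intrD, rmorphB) /=; congr (_%:~R).
have E := divz_eq (numq a * u) p; rewrite -/m in E.
have -> : m = numq a * u - (numq a * u %/ p)%Z * p by apply/eqP; rewrite eq_sym subr_eq [X in _ == X]addrC -E.
rewrite -[X in X - _]mulr1 -uv; ring.
Qed.

(* Main.v *)
Require Import Defs.
From mathcomp Require Import all_boot all_order all_algebra.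
From mathcomp Require Import ring zify.

(** Write T(x, k) = (x)_k (1 - x)_k / k!^2, S_N(x) for the sum of T(x, k) over
    k < N, and D(x, N) = (1 + x)_N (1 - x)_N / N!^2, which is the product of
    1 - x^2 / j^2 over 1 <= j <= N.  For p an odd prime, s in Z_(p) and a < p
    we show, in [sum_gauss_congr],

      S_{np}(p s - a) = (-1)^a S_n(s)   mod p^2.

    Moving x by one: T(x, k) + T(1 + x, k) is a difference in k, so that
    S_N(x) + S_N(1 + x) = 2 D(x, N - 1) ([sum_gauss_term_shift]).  When
    x = p s - i with 0 < i < p, x is a unit of Z_(p), and absorbing it into
    the Pochhammer symbols gives
      D(x, np - 1) = - (np / x)^2 ((x)_{np} / (np)!) ((-x)_{np} / (np)!).
    The last two quotients are binomial coefficients up to sign, hence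
    p-integral ([Zlocal_pochhammer_fact]), so D(x, np - 1) vanishes mod p^2
    ([sine_prod_congr0]).  Applying this a times removes a from p s - a at the
    cost of the sign (-1)^a.

    The case a = 0: cut the sum over k < np into blocks mp <= k < (m + 1) p.
    In D(ps, k) the factors with p | j form D(s, floor(k / p)), and the others
    are 1 mod p^2 ([sine_prod_mulp]).  Hence T(ps, mp) = T(s, m) mod p^2, while
    T(ps, mp + r) = p s D(s, m) / (mp + r) for 0 < r < p; these terms cancel in
    each block because the sum of 1 / (mp + r) vanishes mod p, by the pairing
    of r with p - r.

    For x = 1/d, take a = <-x>_p, so that s = (x + a) / p = r / d where
    r p = 1 + d a.  Then 0 < r < d and r is coprime to d, and for d = 2, 3, 4, 6
    this leaves only r = 1 and r = d - 1.  So s is x or 1 - x, and S_n takes the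
    same value at both. *)

Set Implicit Arguments.
Unset Strict Implicit.
Unset Printing Implicit Defensive.

Import Order.TTheory GRing.Theory Num.Theory.
Local Open Scope ring_scope.

(** * The ring of p-integral rationals and its congruences *)

Section PadicIntegers.
Variable p : nat.
Hypothesis hp : prime p.

Lemma natrat_neq0 (k : nat) : (0 < k)%N -> (k%:R : rat) != 0.
Proof. by move=> k0; rewrite pnatr_eq0 -lt0n. Qed.

(** [Zlocal] speaks of the reduced denominator, which sums and products do not
    respect; any denominator prime to p will do, and those multiply. *)
Lemma Zlocal_witness (q : rat) (d : nat) (w : int) :
  ~~ (p %| d)%N -> q * d%:R = w%:~R -> q \in Zlocal p.
Proof.
move=> pd qd; rewrite inE /=; apply: contra pd => pq.
exact: (dvdn_trans pq (@denq_dvd q w d qd)).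
Qed.

Lemma ZlocalW (q : rat) : q \in Zlocal p ->
  exists2 d : nat, ~~ (p %| d)%N & exists w : int, q * d%:R = w%:~R.
Proof.
rewrite inE /= => pq; exists `|denq q|%N => //; exists (numq q).
by rewrite numqE -[in RHS]absz_denq.
Qed.

Lemma Zlocal_int (z : int) : z%:~R \in Zlocal p.
Proof.
by apply: (@Zlocal_witness _ 1 z); rewrite ?mulr1 // Euclid_dvd1.
Qed.

Lemma Zlocal_nat (k : nat) : k%:R \in Zlocal p.
Proof. exact: (Zlocal_int k). Qed.

Lemma ZlocalM (a b : rat) : a \in Zlocal p -> b \in Zlocal p ->
  a * b \in Zlocal p.
Proof.
move=> /ZlocalW[d pd [w aw]] /ZlocalW[e pe [v bv]].
apply: (@Zlocal_witness _ (d * e) (w * v)).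
  by rewrite Euclid_dvdM // negb_or pd.
by rewrite natrM intrM -aw -bv; ring.
Qed.

Lemma ZlocalD (a b : rat) : a \in Zlocal p -> b \in Zlocal p ->
  a + b \in Zlocal p.
Proof.
move=> /ZlocalW[d pd [w aw]] /ZlocalW[e pe [v bv]].
apply: (@Zlocal_witness _ (d * e) (w * e%:Z + v * d%:Z)).
  by rewrite Euclid_dvdM // negb_or pd.
rewrite natrM intrD !intrM -aw -bv.
by rewrite -!pmulrn; ring.
Qed.

Lemma ZlocalN (a : rat) : a \in Zlocal p -> - a \in Zlocal p.
Proof. by move=> za; rewrite -mulN1r; exact: ZlocalM (Zlocal_int (-1)) za. Qed.

Lemma ZlocalB (a b : rat) : a \in Zlocal p -> b \in Zlocal p ->
  a - b \in Zlocal p.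
Proof. by move=> za zb; rewrite ZlocalD // ZlocalN. Qed.

Lemma ZlocalX (a : rat) (k : nat) : a \in Zlocal p -> a ^+ k \in Zlocal p.
Proof.
move=> za; elim: k => [|k IHk]; first exact: (Zlocal_nat 1).
by rewrite exprS; apply: ZlocalM.
Qed.

Lemma Zlocal_inv_nat (k : nat) : ~~ (p %| k)%N -> k%:R^-1 \in Zlocal p.
Proof.
move=> pk; apply: (@Zlocal_witness _ k 1) => //; rewrite mulVf //.
by apply: natrat_neq0; case: k pk; rewrite ?dvdn0.
Qed.

Lemma Zlocal_sum (I : Type) (r : seq I) (P : pred I) (F : I -> rat) :
  (forall i, P i -> F i \in Zlocal p) -> \sum_(i <- r | P i) F i \in Zlocal p.
Proof.
move=> zF; apply: (big_ind (fun a => a \in Zlocal p)) => //.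
  exact: (Zlocal_nat 0).
exact: ZlocalD.
Qed.

Lemma Zlocal_pochhammer (a : rat) (k : nat) :
  a \in Zlocal p -> pochhammer a k \in Zlocal p.
Proof.
move=> za; apply: (big_ind (fun b => b \in Zlocal p)) => [||i _].
- exact: (Zlocal_nat 1).
- exact: ZlocalM.
- by rewrite ZlocalD // Zlocal_nat.
Qed.

Lemma dvdn_Zlocal (k : nat) : k%:R / p%:R \in Zlocal p -> (p %| k)%N.
Proof.
move=> /ZlocalW[d pd [w kw]].
have p0 := natrat_neq0 (prime_gt0 hp).
have /eqP : (k * d)%:R = (w * p%:Z)%:~R :> rat.
  by rewrite intrM -kw natrM -pmulrn; field.
rewrite pmulrn eqr_int => /eqP kd.
suff : (p %| k * d)%N by rewrite Euclid_dvdM // (negPf pd) orbF.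
have : (p%:Z %| (k * d)%N%:Z)%Z by rewrite kd dvdz_mull.
exact.
Qed.

Lemma Zlocal_inv (a : rat) : a \in Zlocal p -> a / p%:R \notin Zlocal p ->
  a != 0 /\ a^-1 \in Zlocal p.
Proof.
move=> za zap.
have a0 : a != 0.
  by apply: contra zap => /eqP->; rewrite mul0r; exact: (Zlocal_nat 0).
split=> //; have [d pd [w aw]] := ZlocalW za.
have p0 := natrat_neq0 (prime_gt0 hp).
have pw : ~~ (p %| `|w|)%N.
  apply: contra zap => pw; have /dvdzP[v wv] : (p%:Z %| w)%Z by [].
  apply: (@Zlocal_witness _ d v) => //.
  by rewrite mulrAC aw wv intrM -pmulrn mulfK.
apply: (@Zlocal_witness _ `|w| (sgz w * d%:Z)) => //.
rewrite -[d%:Z]/(Posz d) intrM -pmulrn -[RHS](mulKf a0) [a * _]mulrCA aw.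
by rewrite pmulrn abszEsg intrM.
Qed.

Lemma congr_pexpP (e : nat) (a b : rat) :
  reflect (exists2 c, c \in Zlocal p & a = b + p%:R ^+ e * c)
          (congr_pexp p e a b).
Proof.
have p0 : (p%:R : rat) ^+ e != 0.
  by rewrite expf_neq0 // natrat_neq0 // prime_gt0.
apply: (iffP idP) => [ab|[c zc ->]].
  by exists ((a - b) / p%:R ^+ e) => //; field.
by rewrite /congr_pexp [X in X \in _](_ : _ = c) //; field.
Qed.

Lemma congr_pexp_refl (e : nat) (a : rat) : congr_pexp p e a a.
Proof.
by apply/congr_pexpP; exists 0; [exact: (Zlocal_nat 0) | rewrite mulr0 addr0].
Qed.

Lemma congr_pexp_trans (e : nat) (a b c : rat) :
  congr_pexp p e a b -> congr_pexp p e b c -> congr_pexp p e a c.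
Proof.
move=> /congr_pexpP[u zu ->] /congr_pexpP[v zv ->]; apply/congr_pexpP.
by exists (v + u); [exact: ZlocalD | ring].
Qed.

Lemma congr_pexpD (e : nat) (a b c d : rat) :
  congr_pexp p e a b -> congr_pexp p e c d -> congr_pexp p e (a + c) (b + d).
Proof.
move=> /congr_pexpP[u zu ->] /congr_pexpP[v zv ->]; apply/congr_pexpP.
by exists (u + v); [exact: ZlocalD | ring].
Qed.

Lemma congr_pexpMl (e : nat) (c a b : rat) : c \in Zlocal p ->
  congr_pexp p e a b -> congr_pexp p e (c * a) (c * b).
Proof.
move=> zc /congr_pexpP[u zu ->]; apply/congr_pexpP.
by exists (c * u); [exact: ZlocalM | ring].
Qed.

Lemma congr_pexpM (e : nat) (a b c d : rat) :
  b \in Zlocal p -> c \in Zlocal p ->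
  congr_pexp p e a b -> congr_pexp p e c d -> congr_pexp p e (a * c) (b * d).
Proof.
move=> zb zc ab cd; apply: (@congr_pexp_trans _ _ (b * c)).
  by rewrite mulrC [b * c]mulrC; exact: congr_pexpMl.
exact: congr_pexpMl.
Qed.

Lemma congr_pexp_sum (e : nat) (I : Type) (r : seq I) (P : pred I)
    (F G : I -> rat) : (forall i, P i -> congr_pexp p e (F i) (G i)) ->
  congr_pexp p e (\sum_(i <- r | P i) F i) (\sum_(i <- r | P i) G i).
Proof.
move=> FG; apply: (big_ind2 (congr_pexp p e)) => //.
  exact: congr_pexp_refl.
by move=> a b c d; exact: congr_pexpD.
Qed.

(** Natural numbers are dense in Z_(p) for the p-adic topology: the digits of
    the approximation are successive least residues. *)
Lemma Zlocal_approx (e : nat) (a : rat) : a \in Zlocal p ->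
  exists z : nat, congr_pexp p e a z%:R.
Proof.
elim: e a => [|e IHe] a za.
  exists 0%N; apply/congr_pexpP; exists a => //.
  by rewrite expr0 mul1r add0r.
have [_ /congr_pexpP[b zb ->]] := least_residueP hp za.
have [z /congr_pexpP[c zc ->]] := IHe b zb.
exists (least_residue p a + p * z)%N; apply/congr_pexpP; exists c => //.
by rewrite natrD natrM expr1 exprS; ring.
Qed.

Lemma pochhammer_congr (e k : nat) (a b : rat) :
  a \in Zlocal p -> b \in Zlocal p -> congr_pexp p e a b ->
  congr_pexp p e (pochhammer a k) (pochhammer b k).
Proof.
move=> za zb ab; elim: k => [|k IHk].
  by rewrite /pochhammer !big_ord0; exact: congr_pexp_refl.
rewrite /pochhammer !big_ord_recr /=; apply: congr_pexpM => //.
- exact: Zlocal_pochhammer.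
- by rewrite ZlocalD // Zlocal_nat.
- by apply: congr_pexpD => //; exact: congr_pexp_refl.
Qed.

End PadicIntegers.

(** * Pochhammer symbols and the integrality of binomial coefficients *)

Section Pochhammer.

Lemma pochhammer0 (R : pzSemiRingType) (a : R) : pochhammer a 0 = 1.
Proof. by rewrite /pochhammer big_ord0. Qed.

Lemma pochhammerSr (R : pzSemiRingType) (a : R) (k : nat) :
  pochhammer a k.+1 = pochhammer a k * (a + k%:R).
Proof. by rewrite /pochhammer big_ord_recr. Qed.

Lemma pochhammerSl (R : pzSemiRingType) (a : R) (k : nat) :
  pochhammer a k.+1 = a * pochhammer (1 + a) k.
Proof.
rewrite /pochhammer big_ord_recl addr0; congr (_ * _).
by apply: eq_bigr => i _; rewrite /= [1 + a]addrC -addrA nat1r.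
Qed.

Lemma pochhammer1 (R : pzSemiRingType) (k : nat) :
  pochhammer (1 : R) k = (k`!)%:R.
Proof.
elim: k => [|k IHk]; first by rewrite pochhammer0.
by rewrite pochhammerSr IHk factS mulnC natrM nat1r.
Qed.

Lemma pochhammer_nat (R : pzSemiRingType) (z k : nat) :
  pochhammer (z.+1%:R : R) k * (z`!)%:R = ((z + k)`!)%:R.
Proof.
elim: k => [|k IHk]; first by rewrite pochhammer0 mul1r addn0.
rewrite pochhammerSr -natrD -mulrA -natrM mulnC natrM mulrA IHk -natrM.
by rewrite addnS factS mulnC addSn.
Qed.

Lemma pochhammer1_neq0 (k : nat) : pochhammer (1 : rat) k != 0.
Proof. by rewrite pochhammer1 natrat_neq0 // fact_gt0. Qed.

End Pochhammer.

(** Up to sign the quotient is the binomial coefficient C(-a, k).  When a is a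
    positive integer it is an integer; in general one replaces a by a positive
    integer close enough that the error in [pochhammer a k] is still divisible
    by the power of p in k!. *)
Lemma Zlocal_pochhammer_fact (p k : nat) (a : rat) : prime p ->
  a \in Zlocal p -> pochhammer a k / pochhammer 1 k \in Zlocal p.
Proof.
move=> hp za; set v := logn p k`!.
(* a - 1 is approximated, rather than a, to get a positive integer near a. *)
have za1 : a - 1 \in Zlocal p by rewrite ZlocalB // (Zlocal_nat hp 1).
have [z az] := Zlocal_approx hp v za1.
have az1 : congr_pexp p v a z.+1%:R.
  by move: az; rewrite /congr_pexp -natr1 opprD addrA addrAC.
have /(congr_pexpP hp)[c zc ->] :=
  pochhammer_congr hp k za (Zlocal_nat hp z.+1) az1.
rewrite mulrDl pochhammer1; apply: ZlocalD => //.
  suff -> : pochhammer z.+1%:R k = ('C(z + k, k) * k`!)%:R :> rat.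
    by rewrite natrM mulfK ?natrat_neq0 ?fact_gt0 // Zlocal_nat.
  apply: (mulIf (natrat_neq0 (fact_gt0 z))).
  rewrite pochhammer_nat -natrM -(@bin_fact (z + k) k) ?leq_addl //.
  by rewrite addnK mulnA.
have [w pw kE] : exists2 w, ~~ (p %| w)%N & k`! = (p ^ v * w)%N.
  exists (k`! %/ p ^ v)%N; last by rewrite mulnC divnK // pfactor_dvdnn.
  have /(pfactor_coprime hp)[w cw kw] := fact_gt0 k.
  by rewrite -prime_coprime // kw mulnK // expn_gt0 prime_gt0.
have p0 := natrat_neq0 (prime_gt0 hp).
have w0 : (w%:R : rat) != 0.
  by rewrite natrat_neq0 //; case: w pw {kE}; rewrite ?dvdn0.
have -> : p%:R ^+ v * c / (k`!)%:R = c * w%:R^-1 :> rat.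
  by rewrite kE natrM natrX; field; rewrite ?w0 ?p0 ?expf_neq0.
by rewrite ZlocalM // Zlocal_inv_nat.
Qed.

(** * The hypergeometric term and its unit-shift identity *)

Definition gauss_term (x : rat) (k : nat) : rat :=
  pochhammer x k * pochhammer (1 - x) k / pochhammer 1 k ^+ 2.

(** The partial product of 1 - x^2 / j^2 over 1 <= j <= k, from Euler's product
    for sin (pi x) / (pi x); see [sine_prodS]. *)
Definition sine_prod (x : rat) (k : nat) : rat :=
  pochhammer (1 + x) k * pochhammer (1 - x) k / pochhammer 1 k ^+ 2.

Lemma gauss_term_sym (x : rat) (k : nat) :
  gauss_term (1 - x) k = gauss_term x k.
Proof. by rewrite /gauss_term subKr [_ * pochhammer x k]mulrC. Qed.

Lemma gauss_term0 (x : rat) : gauss_term x 0 = 1.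
Proof. by rewrite /gauss_term !pochhammer0; field. Qed.

Lemma sine_prod0 (x : rat) : sine_prod x 0 = 1.
Proof. by rewrite /sine_prod !pochhammer0; field. Qed.

Lemma one_add_nat_neq0 (k : nat) : (1 + k%:R : rat) != 0.
Proof. by rewrite nat1r natrat_neq0. Qed.

Lemma sine_prodS (x : rat) (k : nat) :
  sine_prod x k.+1 = sine_prod x k * (1 - x ^+ 2 / k.+1%:R ^+ 2).
Proof.
rewrite /sine_prod !pochhammerSr -nat1r; field.
by rewrite one_add_nat_neq0 pochhammer1_neq0.
Qed.

(** Both (x)_{k+1} and (1 - x)_{k+1} lose a factor, leaving the symmetric
    product, whose factors are easy to compare modulo p^2. *)
Lemma gauss_termS (x : rat) (k : nat) :
  gauss_term x k.+1 = sine_prod x k * (x * (k.+1%:R - x) / k.+1%:R ^+ 2).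
Proof.
rewrite /gauss_term /sine_prod pochhammerSl 2!pochhammerSr -nat1r; field.
by rewrite one_add_nat_neq0 pochhammer1_neq0.
Qed.

(** T(x, k) + T(1 + x, k) = 2 (D(x, k) - D(x, k - 1)) for k > 0.  For
    x = - y, with y a positive integer and N >= y, the right-hand side is 0; that
    is the relation P_y(-1) + P_{y-1}(-1) = 0 of Legendre polynomials. *)
Lemma sum_gauss_term_shift (x : rat) (N : nat) :
  \sum_(0 <= k < N.+1) (gauss_term x k + gauss_term (1 + x) k) =
  2 * sine_prod x N.
Proof.
elim: N => [|N IHN].
  by rewrite big_nat1 !gauss_term0 sine_prod0 mulr1.
rewrite big_nat_recr // IHN /= /gauss_term /sine_prod.
have -> : 1 - (1 + x) = - x by ring.
rewrite (pochhammerSl x) (pochhammerSl (- x)) !pochhammerSr -nat1r; field.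
by rewrite one_add_nat_neq0 pochhammer1_neq0.
Qed.

(** Absorbing x and - x into the symbols turns D(x, N) into a product of two
    binomial coefficients of order N + 1; the factor (N + 1)^2 is where the
    divisibility by p^2 comes from. *)
Lemma sine_prod_pred (x : rat) (N : nat) : x != 0 ->
  sine_prod x N = - (N.+1%:R / x) ^+ 2 *
    ((pochhammer x N.+1 / pochhammer 1 N.+1) *
     (pochhammer (- x) N.+1 / pochhammer 1 N.+1)).
Proof.
move=> x0; rewrite /sine_prod (pochhammerSl x) (pochhammerSl (- x)).
rewrite pochhammerSr -nat1r; field.
by rewrite one_add_nat_neq0 pochhammer1_neq0.
Qed.

(** * Congruences modulo the square of a prime *)

Section Congruences.
Variable p : nat.
Hypothesis hp : prime p.

Lemma Zlocal_gauss_term (x : rat) (k : nat) :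
  x \in Zlocal p -> gauss_term x k \in Zlocal p.
Proof.
move=> zx; rewrite /gauss_term expr2 -mulf_div.
by apply: ZlocalM => //; apply: Zlocal_pochhammer_fact => //;
  rewrite ZlocalB // (Zlocal_nat hp 1).
Qed.

Lemma Zlocal_sine_prod (x : rat) (k : nat) :
  x \in Zlocal p -> sine_prod x k \in Zlocal p.
Proof.
move=> zx; rewrite /sine_prod expr2 -mulf_div.
by apply: ZlocalM => //; apply: Zlocal_pochhammer_fact => //;
  rewrite ?ZlocalB ?ZlocalD // (Zlocal_nat hp 1).
Qed.

(** Here x = ps - i is prime to p because i is, so in [sine_prod_pred] with
    N + 1 = np the power (np / x)^2 keeps its factor p^2. *)
Lemma sine_prod_congr0 (s : rat) (i n : nat) : s \in Zlocal p ->
  (0 < i < p)%N -> (0 < n)%N ->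
  congr_pexp p 2 (sine_prod (p%:R * s - i%:R) (n * p).-1) 0.
Proof.
move=> zs /andP[i0 ip] n0; set x := p%:R * s - i%:R.
have pi : ~~ (p %| i)%N by rewrite gtnNdvd.
have zx : x \in Zlocal p by rewrite ZlocalB ?ZlocalM ?Zlocal_nat.
have [x0 zVx] : x != 0 /\ x^-1 \in Zlocal p.
  apply: Zlocal_inv => //; apply: contra pi => xp.
  apply: dvdn_Zlocal => //.
  have -> : i%:R / p%:R = s - x / p%:R :> rat.
    by rewrite /x; field; rewrite natrat_neq0 ?prime_gt0.
  exact: ZlocalB.
apply/(congr_pexpP hp).
exists (- (n%:R / x) ^+ 2 *
    ((pochhammer x (n * p) / pochhammer 1 (n * p)) *
     (pochhammer (- x) (n * p) / pochhammer 1 (n * p)))).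
  apply: ZlocalM => //.
    by rewrite ZlocalN // ZlocalX // ZlocalM // Zlocal_nat.
  by apply: ZlocalM => //; apply: Zlocal_pochhammer_fact => //; rewrite ZlocalN.
rewrite sine_prod_pred // prednK ?muln_gt0 ?n0 ?prime_gt0 // natrM; ring.
Qed.

(** The factor of D(ps, k) at j = p i is the factor of D(s, floor(k / p)) at i,
    and the factors at j prime to p are 1 mod p^2.  The ratio is kept as an
    exact factor u: the single factors 1 - s^2 / i^2 need not be p-integral, so
    a mere congruence could not be propagated through them. *)
Lemma sine_prod_mulp (s : rat) (k : nat) : s \in Zlocal p ->
  exists2 u, congr_pexp p 2 u 1 &
    sine_prod (p%:R * s) k = sine_prod s (k %/ p) * u.
Proof.
move=> zs; have p_gt0 := prime_gt0 hp; have p0 := natrat_neq0 p_gt0.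
elim: k => [|k [u u1 IHk]].
  exists 1; first exact: congr_pexp_refl.
  by rewrite div0n !sine_prod0 mulr1.
rewrite sine_prodS IHk divnS //; case: (boolP (p %| k.+1)%N) => [pk|pk].
  exists u => //; rewrite add1n sine_prodS.
  have -> : (k.+1 = (k %/ p).+1 * p)%N.
    by rewrite -[LHS](divnK pk) divnS // pk add1n.
  by rewrite natrM; field; rewrite nat1r natrat_neq0.
exists (u * (1 - (p%:R * s) ^+ 2 / k.+1%:R ^+ 2)); last by rewrite add0n mulrA.
rewrite -[1 in X in congr_pexp p 2 _ X]mulr1.
apply: congr_pexpM => //; first exact: (Zlocal_nat hp 1).
  rewrite -expr_div_n; apply: (ZlocalB hp); first exact: (Zlocal_nat hp 1).
  by rewrite ZlocalX // !ZlocalM ?Zlocal_inv_nat ?Zlocal_nat.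
apply/(congr_pexpP hp); exists (- (s / k.+1%:R) ^+ 2).
  by rewrite ZlocalN // ZlocalX // ZlocalM // Zlocal_inv_nat.
by field; rewrite nat1r natrat_neq0.
Qed.

Lemma gauss_term_mulp (s : rat) (m : nat) : s \in Zlocal p ->
  congr_pexp p 2 (gauss_term (p%:R * s) (m * p)) (gauss_term s m).
Proof.
move=> zs; case: m => [|m].
  by rewrite mul0n !gauss_term0; exact: congr_pexp_refl.
have p_gt0 := prime_gt0 hp.
have mpS : ((m.+1 * p).-1.+1 = m.+1 * p)%N by rewrite prednK // muln_gt0.
have [u u1 Du] := sine_prod_mulp (m.+1 * p).-1 zs.
have dE : ((m.+1 * p).-1 %/ p = m)%N.
  have -> : ((m.+1 * p).-1 = m * p + p.-1)%N by rewrite mulSn; lia.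
  by rewrite divnMDl // divn_small ?addn0 // prednK.
have -> : gauss_term (p%:R * s) (m.+1 * p) = gauss_term s m.+1 * u.
  rewrite -[in LHS]mpS !gauss_termS Du dE mpS natrM; field.
  by rewrite nat1r !natrat_neq0.
rewrite -[X in congr_pexp p 2 _ X]mulr1; apply: congr_pexpMl => //.
exact: Zlocal_gauss_term.
Qed.

(** The term carries one factor p from its leading x = ps, so only D(s, m) and
    the linear term in 1 / k survive in it modulo p^2. *)
Lemma gauss_term_mulp_add (s : rat) (m r : nat) : s \in Zlocal p ->
  (0 < r < p)%N ->
  congr_pexp p 2 (gauss_term (p%:R * s) (m * p + r))
                 (p%:R * (s * sine_prod s m * (m * p + r)%:R^-1)).
Proof.
move=> zs /andP[r0 rp]; case: r r0 rp => // r _ rp; rewrite addnS.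
set k := (m * p + r)%N.
have kp : (k %/ p = m)%N.
  by rewrite /k divnMDl ?prime_gt0 // divn_small ?addn0 // ltnW.
have pk : ~~ (p %| k.+1)%N.
  by rewrite /k -addnS dvdn_addr ?dvdn_mull // gtnNdvd.
have [u /(congr_pexpP hp)[c zc uE] Du] := sine_prod_mulp k zs.
rewrite gauss_termS Du kp uE; apply/(congr_pexpP hp).
(* The exact term is D(s, m) u (ps / k.+1) (1 - ps / k.+1), u = 1 + p^2 c: the
   first summand collects the error of u, the second is the term in s^2. *)
exists (sine_prod s m * s * k.+1%:R^-1 * (p%:R * c)
        - sine_prod s m * (s * k.+1%:R^-1) ^+ 2 * (1 + p%:R ^+ 2 * c)).
  have zD := Zlocal_sine_prod m zs; have zk := Zlocal_inv_nat pk.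
  have zsk : s * k.+1%:R^-1 \in Zlocal p by exact: ZlocalM.
  have zpc (e : nat) : p%:R ^+ e * c \in Zlocal p.
    by rewrite ZlocalM // ZlocalX // Zlocal_nat.
  apply: (ZlocalB hp); apply: (ZlocalM hp).
  - by rewrite -mulrA ZlocalM.
  - exact: (zpc 1%N).
  - by rewrite ZlocalM // ZlocalX.
  - by rewrite ZlocalD // (Zlocal_nat hp 1).
by field; rewrite nat1r natrat_neq0.
Qed.

(** In the doubled sum r meets p - r, and the two denominators mp + r and
    mp + (p - r) add up to the multiple (2m + 1) p of p. *)
Lemma sum_inv_block_congr0 (m : nat) : (2 < p)%N ->
  congr_pexp p 1 (\sum_(1 <= r < p) (m * p + r)%:R^-1) 0.
Proof.
move=> p2; set S := \sum_(_ <= _ < _) _.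
pose c := \sum_(1 <= r < p)
  (2 * m + 1)%:R * ((m * p + r)%:R^-1 * (m * p + (p - r))%:R^-1) : rat.
have pN (r : nat) : (0 < r < p)%N -> ~~ (p %| m * p + r)%N.
  by move=> /andP[r0 rp]; rewrite dvdn_addr ?dvdn_mull // gtnNdvd.
have S2 : 2 * S = p%:R * c.
  rewrite mulr_natl mulr2n {2}/S big_nat_rev /= -big_split mulr_sumr.
  rewrite big_nat [RHS]big_nat; apply: eq_bigr => r /andP[r0 rp].
  have -> : (1 + p - r.+1 = p - r)%N by lia.
  have -> : (m * p + (p - r))%:R =
      (2 * m + 1)%:R * p%:R - (m * p + r)%:R :> rat.
    by rewrite -natrM -natrB; [congr (_%:R); lia | lia].
  have h1 : ((m * p + r)%:R : rat) != 0 by rewrite natrat_neq0; lia.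
  have h2 : (2 * m + 1)%:R * p%:R - (m * p + r)%:R != 0 :> rat.
    by rewrite -natrM -natrB; [rewrite natrat_neq0; lia | lia].
  rewrite -[LHS]/(_^-1 + _^-1); move: h1 h2.
  set u := (m * p + r)%:R; set v := (2 * m + 1)%:R => h1 h2; clearbody u v.
  by field; rewrite h2 h1.
apply/(congr_pexpP hp); exists (2%:R^-1 * c).
  apply: ZlocalM => //; first by rewrite Zlocal_inv_nat // gtnNdvd.
  rewrite /c big_nat_cond; apply: Zlocal_sum => // r; rewrite andbT => rp.
  apply: ZlocalM => //; first exact: Zlocal_nat.
  by apply: ZlocalM => //; apply: Zlocal_inv_nat => //; apply: pN; lia.
have -> : S = 2^-1 * (2 * S) by field.
by rewrite S2; ring.
Qed.

Lemma gauss_block_congr (s : rat) (m : nat) : (2 < p)%N -> s \in Zlocal p ->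
  congr_pexp p 2 (\sum_(0 <= r < p) gauss_term (p%:R * s) (m * p + r))
                 (gauss_term s m).
Proof.
move=> p2 zs; rewrite big_ltn ?prime_gt0 // addn0.
rewrite -[X in congr_pexp p 2 _ X]addr0.
apply: congr_pexpD => //; first exact: gauss_term_mulp.
apply: (@congr_pexp_trans _ hp _ _
    (p%:R * (s * sine_prod s m * \sum_(1 <= r < p) (m * p + r)%:R^-1))).
  rewrite mulr_sumr mulr_sumr big_nat [X in congr_pexp p 2 _ X]big_nat.
  by apply: congr_pexp_sum => // r; exact: gauss_term_mulp_add.
have /(congr_pexpP hp)[c zc ->] := sum_inv_block_congr0 m p2.
apply/(congr_pexpP hp); exists (s * sine_prod s m * c); last by ring.
by apply: ZlocalM => //; apply: ZlocalM => //; exact: Zlocal_sine_prod.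
Qed.

Lemma sum_gauss_mulp (s : rat) (n : nat) : (2 < p)%N -> s \in Zlocal p ->
  congr_pexp p 2 (\sum_(0 <= k < n * p) gauss_term (p%:R * s) k)
                 (\sum_(0 <= k < n) gauss_term s k).
Proof.
move=> p2 zs; elim: n => [|n IHn].
  by rewrite mul0n !big_geq //; exact: congr_pexp_refl.
rewrite (@big_cat_nat _ _ _ (n * p)%N) ?leq_mul //= big_nat_recr //=.
apply: congr_pexpD => //; rewrite -{1}[(n * p)%N]add0n big_addn mulSn addnK.
under eq_bigr => r _ do rewrite addnC.
exact: gauss_block_congr.
Qed.

(** Induction on a: raising x = ps - (a + 1) by one gives ps - a, which changes
    the sign of the sum modulo p^2. *)
Lemma sum_gauss_congr (s : rat) (a n : nat) : (2 < p)%N -> s \in Zlocal p ->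
  (a < p)%N -> (0 < n)%N ->
  congr_pexp p 2 (\sum_(0 <= k < n * p) gauss_term (p%:R * s - a%:R) k)
                 ((-1) ^+ a * \sum_(0 <= k < n) gauss_term s k).
Proof.
move=> p2 zs ap n0; elim: a ap => [|a IHa] ap.
  by rewrite subr0 mul1r; exact: sum_gauss_mulp.
set x := p%:R * s - a.+1%:R.
have xE : p%:R * s - a%:R = 1 + x by rewrite /x -natr1; ring.
have np : ((n * p).-1.+1 = n * p)%N by rewrite prednK // muln_gt0 n0 prime_gt0.
have -> : \sum_(0 <= k < n * p) gauss_term x k =
    2 * sine_prod x (n * p).-1 +
    (-1) * \sum_(0 <= k < n * p) gauss_term (1 + x) k.
  by rewrite -sum_gauss_term_shift np big_split /=; ring.
rewrite exprS -mulrA -[X in congr_pexp p 2 _ X]add0r -(mulr0 2).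
apply: congr_pexpD => //; apply: congr_pexpMl => //.
- exact: (Zlocal_nat hp 2).
- exact: sine_prod_congr0.
- exact: (Zlocal_int hp (-1)).
- by rewrite -xE; apply: IHa; exact: ltnW.
Qed.

End Congruences.

(** * Unit fractions with denominator 2, 3, 4 or 6 *)

(** The quotient (1 + d a) / p lies strictly between 0 and d and is prime to d;
    2, 3, 4 and 6 are the d > 1 for which only 1 and d - 1 are such. *)
Lemma unit_fraction_shift (p d a : nat) : d \in [:: 2; 3; 4; 6]%N ->
  (a < p)%N -> (p %| 1 + d * a)%N ->
  (1 + d * a = p)%N \/ (1 + d * a = (d - 1) * p)%N.
Proof.
move=> hd ap /dvdnP[r rE].
have rd : (r < d)%N.
  by move: hd; rewrite !inE => /or4P[] /eqP dE; subst d; nia.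
by move: hd; rewrite !inE => /or4P[] /eqP dE; subst d;
  do 6?[case: r rE rd => [|r] rE rd; try lia].
Qed.

Theorem theorem1p3 (p n : nat) (x : rat) (hp : prime p) (hp5 : (5 <= p)%N)
    (hn : (0 < n)%N) (hx : x \in [:: 1 / 2; 1 / 3; 1 / 4; 1 / 6]) :
  congr_pexp p 2
    (\sum_(0 <= k < n * p)
       pochhammer x k * pochhammer (1 - x) k / pochhammer 1 k ^+ 2)
    ((-1) ^+ least_residue p (- x) *
     \sum_(0 <= k < n)
       pochhammer x k * pochhammer (1 - x) k / pochhammer 1 k ^+ 2).
Proof.
have [d hd xE] : exists2 d : nat, d \in [:: 2; 3; 4; 6]%N & x = d%:R^-1.
  by move: hx; rewrite !inE => /or4P[] /eqP->;
    [exists 2%N | exists 3%N | exists 4%N | exists 6%N] => //; rewrite div1r.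
have d0 : (d%:R : rat) != 0.
  by rewrite natrat_neq0 //; move: hd; rewrite !inE => /or4P[] /eqP->.
have pd : ~~ (p %| d)%N.
  have p3 : (p %| 3)%N = false by rewrite gtnNdvd //; lia.
  have p2 : (p %| 2)%N = false by rewrite gtnNdvd //; lia.
  move: hd; rewrite !inE => /or4P[] /eqP->.
  - by rewrite p2.
  - by rewrite p3.
  - by rewrite (Euclid_dvdM 2 2) // p2.
  - by rewrite (Euclid_dvdM 2 3) // p2 p3.
have zx : x \in Zlocal p by rewrite xE Zlocal_inv_nat.
have [ap] := least_residueP hp (ZlocalN hp zx).
set a := least_residue p (- x) in ap *; rewrite /congr_pexp expr1 => za.
have p0 := natrat_neq0 (prime_gt0 hp).
pose s := (x + a%:R) / p%:R.
have zs : s \in Zlocal p.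
  have -> : s = - ((- x - a%:R) / p%:R) by rewrite /s; field.
  exact: ZlocalN.
have pda : (p %| 1 + d * a)%N.
  apply: dvdn_Zlocal => //.
  have -> : (1 + d * a)%:R / p%:R = d%:R * s :> rat.
    by rewrite /s xE natrD natrM; field; rewrite p0 d0.
  by rewrite ZlocalM // Zlocal_nat.
(* s is x or 1 - x, and the term is symmetric under x -> 1 - x. *)
have sx k : gauss_term s k = gauss_term x k.
  have sE : s = (1 + d * a)%:R / (d%:R * p%:R).
    by rewrite /s xE natrD natrM; field; rewrite p0 d0.
  case: (unit_fraction_shift hd ap pda) => daE.
    by congr gauss_term; rewrite sE daE xE; field; rewrite p0 d0.
  rewrite -gauss_term_sym; congr gauss_term.
  rewrite sE daE natrM natrB ?xE; first by field; rewrite p0 d0.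
  by move: hd; rewrite !inE => /or4P[] /eqP->.
have xs : x = p%:R * s - a%:R by rewrite /s; field.
have p2 : (2 < p)%N by lia.
have := sum_gauss_congr hp p2 zs ap hn; rewrite -xs.
by under [X in _ * X]eq_bigr => k _ do rewrite sx.
Qed.
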